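(* Let $r\ge 2$ be an integer, let $w(x)=x^\alpha(1-x)^\beta$ with $\alpha,\beta>0$, and let $\phi$ be an admissible step-weight function with exponents $\beta(0),\beta(1)$ satisfying $\min\{\beta(0),\beta(1)\}\ge \frac12$. Then there is a constant $C>0$, independent of $n$, $x$ and $f$, such that for every $f\in C_w$, every admissible $n$ and every $x\in[0,1]$, $$\left|w(x)\phi^{r}(x)\,B^{\ast(r)}_{n,r-1}(f,x)\right|\le C\,n^{r/2}\,\|wf\|,$$ where $B^{\ast(r)}_{n,r-1}(f,x)$ denotes the $r$-th derivative in $x$ of $B^{\ast}_{n,r-1}(f,x)$.
   Context: Weights and spaces: $w(x)=x^\alpha(1-x)^\beta$ on $[0,1]$. $C_w$ is the set of $f\in C((0,1))$ with $\lim_{x\to0}(wf)(x)=\lim_{x\to1}(wf)(x)=0$, with norm $\|wf\|=\sup_{0<x<1}|(wf)(x)|$. Admissible step-weight function: $\phi:[0,1]\to\mathbb R$ such that (I) for every $[a,b]\subset(0,1)$ there is $M_1=M(a,b)>0$ with $M_1^{-1}\le\phi(x)\le M_1$ on $[a,b]$; (II) there are numbers $\beta(0),\beta(1)\ge0$ with $\phi(x)\sim x^{\beta(0)}$ as $x\to0+$ and $\phi(x)\sim(1-x)^{\beta(1)}$ as $x\to1-$ ($X\sim Y$ means $C^{-1}Y\le X\le CY$ for some $C>0$). Consequently $M^{-1}x^{\beta(0)}(1-x)^{\beta(1)}\le\phi(x)\le Mx^{\beta(0)}(1-x)^{\beta(1)}$ on $[0,1]$ for some constant $M>0$. Bernstein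 operators: $B_m(g,x)=\sum_{k=0}^m g(k/m)\binom mk x^k(1-x)^{m-k}$. For an integer $s\ge1$, the combinations are $B_{n,s}(g,x)=\sum_{i=0}^{s-1}C_i(n)B_{n_i}(g,x)$, where the integers $n_i=n_i(n)$ and reals $C_i(n)$ are fixed and satisfy, with an absolute constant $C$ independent of $n$: (a) $n=n_0<n_1<\dots<n_{s-1}\le Cn$; (b) $\sum_{i}|C_i(n)|\le C$; (c) $\sum_i C_i(n)=1$; (d) $\sum_i C_i(n)n_i^{-k}=0$ for $k=1,\dots,s-1$. Modified function: fix a non-decreasing $\psi\in C^\infty(\mathbb R)$ with $\psi=0$ on $(-\infty,0]$ and $\psi=1$ on $[1,\infty)$. For $n>\max\{r,3\}$ (the admissible $n$) let $L_r(f,x)=\sum_{i=1}^r f(i/n)\,l_i(x)$ be the Lagrange polynomial of degree $\le r-1$ interpolating $f$ at $i/n$, $i=1,\dots,r$, and $R_r(f,x)$ the one interpolating $f$ at $1-i/n$, $i=1,\dots,r$. Define $F_n(x)=F_n(f,x)$ by $$F_n(x)=\begin{cases} L_r(f,x), & x\in[0,\frac1n], \\ (1-\psi(nx-1))L_r(f,x)+\psi(nx-1)f(x), & x\in[\frac1n,\frac2n], \\ f(x), & x\in[\frac2n,1-\frac2n], \\ (1-\psi(n(1-x)-1))R_r(f,x)+\psi(n(1-x)-1)f(x), & x\in[1-\frac2n,1-\frac1n], \\ R_r(f,x), & x\in[1-\frac1n,1]. \end{cases}$$ Finally $B^\ast_{n,r-1}(f,x)=B_{n,r-1}(F_n,x)$.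 Constants may depend on $r,\alpha,\beta,\phi,\psi$ and the constant in (a),(b). *)

(* Defs.v *)
From HB Require Import structures.
From mathcomp Require Import all_boot all_order all_algebra.
From mathcomp Require Import all_classical all_reals all_analysis.

Set Implicit Arguments.
Unset Strict Implicit.
Unset Printing Implicit Defensive.

Import Order.TTheory GRing.Theory Num.Theory.
Import numFieldNormedType.Exports.

Local Open Scope classical_set_scope.
Local Open Scope ring_scope.

Section Defs.
Context {R : realType}.
Implicit Types (f g phi psi w : R -> R) (x : R).

(* Since 0 `^ a = 0 for a != 0, this vanishes at 0 and 1 when alpha, beta > 0. *)
Definition jacobi_weight (alpha beta : R) : R -> R :=
  fun x => x `^ alpha * (1 - x) `^ beta.

(* C_w: elements are functions on (0,1), represented by total functions whose
   values outside (0,1) are irrelevant. *)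
Record in_Cw w f : Prop := InCw {
  Cw_continuous : {in `]0, 1[, continuous f} ;
  Cw_lim0 : w x * f x @[x --> 0^'+] --> (0 : R) ;
  Cw_lim1 : w x * f x @[x --> 1^'-] --> (0 : R) }.

Definition Cw_norm w f : R := sup [set `|w x * f x| | x in `]0, 1[].

Definition same_order (F : set_system R) f g : Prop :=
  exists2 C : R, 0 < C & \forall x \near F, C^-1 * g x <= f x <= C * g x.

(* phi lives on [0,1]; its values elsewhere are unconstrained. *)
Record step_weight phi (b0 b1 : R) : Prop := StepWeight {
  step_weight_bounded : forall a b : R, 0 < a -> a <= b -> b < 1 ->
    exists2 M : R, 0 < M & forall x, a <= x <= b -> M^-1 <= phi x <= M ;
  step_weight_exp0 : 0 <= b0 ;
  step_weight_exp1 : 0 <= b1 ;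
  step_weight_near0 : same_order (0 : R)^'+ phi (fun x => x `^ b0) ;
  step_weight_near1 : same_order (1 : R)^'- phi (fun x => (1 - x) `^ b1) }.

Definition bernstein (m : nat) g : R -> R := fun x =>
  \sum_(k < m.+1) g (k%:R / m%:R) * 'C(m, k)%:R * x ^+ k * (1 - x) ^+ (m - k).

(* nodes n i is n_i(n) and coef n i is C_i(n), for i < s. *)
Record bernstein_scheme (s : nat) (K : R)
    (nodes : nat -> nat -> nat) (coef : nat -> nat -> R) : Prop :=
  BernsteinScheme {
  scheme_first : forall n, (0 < n)%N -> nodes n 0%N = n ;
  scheme_incr : forall n i, (0 < n)%N -> (i.+1 < s)%N ->
    (nodes n i < nodes n i.+1)%N ;
  scheme_last : forall n, (0 < n)%N -> (nodes n s.-1)%:R <= K * n%:R ;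
  scheme_coef_bounded : forall n, (0 < n)%N -> \sum_(i < s) `|coef n i| <= K ;
  scheme_coef_sum : forall n, (0 < n)%N -> \sum_(i < s) coef n i = 1 ;
  scheme_moments : forall n k, (0 < n)%N -> (1 <= k <= s.-1)%N ->
    \sum_(i < s) coef n i * (nodes n i)%:R ^- k = 0 }.

Definition bernstein_comb (nodes : nat -> nat -> nat) (coef : nat -> nat -> R)
    (n s : nat) g : R -> R := fun x =>
  \sum_(i < s) coef n i * bernstein (nodes n i) g x.

Record smooth_step psi : Prop := SmoothStep {
  smooth_step_nondecreasing : {homo psi : x y / x <= y} ;
  smooth_step_smooth : forall (k : nat) x, derivable (derive1n k psi) x 1 ;
  smooth_step_left : forall x, x <= 0 -> psi x = 0 ;
  smooth_step_right : forall x, 1 <= x -> psi x = 1 }.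

(* Interpolation of f at the r points t 1, ..., t r. *)
Definition lagrange_interp (r : nat) (t : nat -> R) f : R -> R := fun x =>
  \sum_(1 <= i < r.+1)
    f (t i) * \prod_(1 <= j < r.+1 | j != i) ((x - t j) / (t i - t j)).

Definition left_interp (r n : nat) f : R -> R :=
  lagrange_interp r (fun i => i%:R / n%:R) f.

Definition right_interp (r n : nat) f : R -> R :=
  lagrange_interp r (fun i => 1 - i%:R / n%:R) f.

(* For n > 3 and psi a smooth step, adjacent pieces agree at the breakpoints. *)
Definition modified psi (r n : nat) f : R -> R := fun x =>
  let nR : R := n%:R in
  if x <= 1 / nR then left_interp r n f x
  else if x <= 2 / nR then
    (1 - psi (nR * x - 1)) * left_interp r n f x + psi (nR * x - 1) * f x
  else if x <= 1 - 2 / nR then f x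
  else if x <= 1 - 1 / nR then
    (1 - psi (nR * (1 - x) - 1)) * right_interp r n f x
      + psi (nR * (1 - x) - 1) * f x
  else right_interp r n f x.

Definition bernstein_star psi nodes coef (r n : nat) f : R -> R :=
  bernstein_comb nodes coef n r.-1 (modified psi r n f).

End Defs.

(* Main.v *)
Require Import Defs.
From HB Require Import structures.
From mathcomp Require Import all_boot all_order all_algebra.
From mathcomp Require Import all_classical all_reals all_analysis.
From mathcomp Require Import cyclic separable cyclotomic complex.
From mathcomp Require Import zify ring lra.

(** The [r]-th derivative at [x] of the basis polynomial
    [p_k = C(m,k) X^k (1-X)^(m-k)] is estimated by Cauchy's formula on the
    complex circle of centre [x] and radius [h = sqrt (x (1-x) / m)], with the
    contour integral replaced by an average over roots of unity of large order,
    which is exact on polynomials.  On that circle AM-GM gives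
    [|z| <= P := (|z|^2 + x^2) / (2x)] and
    [|1-z| <= Q := (|1-z|^2 + (1-x)^2) / (2 (1-x))], where [P >= x/2],
    [Q >= (1-x)/2] and [P + Q = 1 + 1/(2m)] exactly.  Hence
    [sum_k c_k |p_k(z)|] is at most [sum_k c_k C(m,k) P^k Q^(m-k)], and for
    [c_k] the values at [k/m] of the reciprocal weight this is
    [O(1 / w(x))], uniformly in [0 < x < 1], because
    [C(m,k) (m/(k+1))^a <= a! C(m+a,k+a)].  The factor [h^-r] is
    [m^(r/2) (x (1-x))^(-r/2)], which [phi^r] absorbs since
    [phi = O(sqrt (x (1-x)))].  Interpolation at [i/n], [1 - i/n] keeps
    [|F_n|] below a multiple of [||wf||] over the weight shifted by [1/n]. *)

Set Implicit Arguments.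
Unset Strict Implicit.
Unset Printing Implicit Defensive.

Import Order.TTheory GRing.Theory Num.Theory.
Import numFieldNormedType.Exports.

Local Open Scope classical_set_scope.
Local Open Scope ring_scope.

(** * Roots of unity and a discrete Cauchy estimate *)

(** In characteristic 0 the polynomial [X^n - 1] is separable, so it has [n] distinct roots, and [n]
    distinct [n]-th roots of unity include a primitive one. *)
Lemma prim_root_exists (C : numClosedFieldType) (n : nat) :
  (0 < n)%N -> exists z : C, n.-primitive_root z.
Proof.
move=> n_gt0; pose p : {poly C} := 'X^n - 1.
have [s Dp] := closed_field_poly_normal p.
rewrite (monicP _) ?monicXnsubC // scale1r in Dp.
have sn1 : all n.-unity_root s.
  by apply/allP => z; rewrite -root_prod_XsubC -Dp.
have sz_s : (n < (size s).+1)%N.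
  by rewrite -(size_prod_XsubC s id) -Dp size_XnsubC.
have [|z] := hasP (has_prim_root n_gt0 sn1 _ sz_s); last by exists z.
by rewrite -separable_prod_XsubC -Dp separable_Xn_sub_1 // pnatr_eq0 -lt0n.
Qed.

Lemma sum_prim_root_expr (F : fieldType) (n k : nat) (z : F) :
  n.-primitive_root z ->
  \sum_(j < n) (z ^+ k) ^+ j = if (n %| k)%N then n%:R else 0.
Proof.
move=> pz; case: ifP => [/dvdnP[q ->]|ndvd].
  rewrite mulnC exprM (prim_expr_order pz).
  by under eq_bigr do rewrite !expr1n; rewrite sumr_const card_ord.
have zk1 : z ^+ k - 1 != 0 by rewrite subr_eq0 -(prim_order_dvd pz) ndvd.
apply: (mulfI zk1); rewrite mulr0 -subrX1 -exprM mulnC exprM.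
by rewrite (prim_expr_order pz) expr1n subrr.
Qed.

Lemma normr_prim_root (C : numClosedFieldType) (n : nat) (z : C) :
  n.-primitive_root z -> `|z| = 1.
Proof.
move=> pz; apply/eqP.
rewrite -(pexpr_eq1 (prim_order_gt0 pz) (normr_ge0 z)) -normrX.
by rewrite (prim_expr_order pz) normr1.
Qed.

(** Taylor-expand each [p(x + h z^j)] and sum over [j]: orthogonality of the powers of [z] keeps one
    Taylor coefficient. The exponent [n - r] stands for [-r], and [size p <= n] excludes
    aliasing. *)
Lemma nderivn_unity_roots (F : fieldType) (n r : nat) (z x h : F)
    (p : {poly F}) :
  n.-primitive_root z -> (size p <= n)%N -> (r < n)%N ->
  n%:R * (p^`N(r).[x] * h ^+ r) =
  \sum_(j < n) (z ^+ (n - r)) ^+ j * p.[x + h * z ^+ j].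
Proof.
move=> pz sp rn.
transitivity (\sum_(i < n) \sum_(j < n)
    p^`N(i).[x] * h ^+ i * (z ^+ (i + (n - r))) ^+ j).
  transitivity (\sum_(i < n)
      if i == Ordinal rn then n%:R * (p^`N(r).[x] * h ^+ r) else 0).
    by rewrite -big_mkcond big_pred1_eq.
  apply: eq_bigr => i _; rewrite -mulr_sumr (sum_prim_root_expr _ pz).
  (* As [i] and [r] are below [n], the number [i + (n - r)] lies strictly between [0] and [2n], so
     the quotient can only be 1, which means [i = r]. *)
  have -> : (n %| i + (n - r))%N = (i == Ordinal rn).
    apply/idP/eqP => [/dvdnP[q qE]|-> /=]; last by rewrite subnKC // ltnW.
    apply/val_inj => /=; have in_ := ltn_ord i.
    case: q qE => [|[|q]] qE.
    - by move: qE; rewrite mul0n => /eqP; rewrite addn_eq0 subn_eq0 leqNgt rn andbF.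
    - by move: qE; rewrite mul1n; lia.
    - by move: qE; rewrite mulSn mulSn; lia.
  by case: eqP => [->|_] /=; rewrite ?mulr0 // mulrC.
rewrite exchange_big; apply: eq_bigr => j _.
rewrite (nderiv_taylor_wide (n := n)) //; last exact: mulrC.
rewrite mulr_sumr; apply: eq_bigr => i _.
rewrite exprMn exprD exprMn -!exprM [(i * j)%N]mulnC; ring.
Qed.

Lemma cauchy_estimate (C : numClosedFieldType) (n r : nat) (z x h : C)
    (p : {poly C}) :
  n.-primitive_root z -> (size p <= n)%N -> (r < n)%N -> 0 <= h ->
  `|p^`N(r).[x]| * h ^+ r <= n%:R^-1 * \sum_(j < n) `|p.[x + h * z ^+ j]|.
Proof.
move=> pz sp rn h0; have n0 : 0 < n%:R :> C.
  by rewrite ltr0n (leq_ltn_trans _ rn).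
rewrite ler_pdivlMl // -{1}(ger0_norm (exprn_ge0 r h0)) -normrM.
rewrite -{1}(ger0_norm (ltW n0)) -normrM (nderivn_unity_roots x h pz sp rn).
apply: le_trans (ler_norm_sum _ _ _) _; apply: ler_sum => j _.
by rewrite normrM !normrX (normr_prim_root pz) !expr1n mul1r.
Qed.

(* AM-GM for |x + h u|^2 = x^2 + 2 x h Re u + h^2 and x^2: unlike in the
   triangle inequality, the first-order term of the bound is linear in u, so it
   cancels between x and 1 - x. *)
Lemma norm_shift_le (C : numClosedFieldType) (x h u : C) :
  0 < x -> h \is Num.real -> `|u| = 1 ->
  `|x + h * u| <= x + h * 'Re u + h ^+ 2 / (2 * x).
Proof.
move=> x0 hr u1; have xr : x \is Num.real by rewrite realE ltW.
set y : C := `|x + h * u|.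
have y0 : 0 <= y by exact: normr_ge0.
have yE : y ^+ 2 = x ^+ 2 + 2 * x * h * 'Re u + h ^+ 2.
  rewrite /y normCK rmorphD rmorphM /= (CrealP xr) (CrealP hr).
  rewrite ReE.
  have uu : u * u^* = 1 by rewrite -normCK u1 expr1n.
  transitivity (x ^+ 2 + x * h * (u + u^*) + h ^+ 2 * (u * u^*)); first by ring.
  by rewrite uu; field; rewrite ?pnatr_eq0.
have -> : x + h * 'Re u + h ^+ 2 / (2 * x) = (y ^+ 2 + x ^+ 2) / (2 * x).
  by rewrite yE; field; rewrite gt_eqF.
rewrite ler_pdivlMr ?mulr_gt0 // -subr_ge0.
have -> : y ^+ 2 + x ^+ 2 - y * (2 * x) = (y - x) ^+ 2 by ring.
by rewrite real_exprn_even_ge0 // rpredB // realE y0.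
Qed.

(** Completing the square: the excess over [x / 2] is [(x - h)^2 / (2x) + h (c + 1)], and
    [c >= -1]. *)
Lemma half_le_shift (R : realFieldType) (x h c : R) :
  0 < x -> 0 <= h -> `|c| <= 1 -> x / 2 <= x + h * c + h ^+ 2 / (2 * x).
Proof.
move=> x0 h0; rewrite ler_norml => /andP[c1 _].
have -> : x + h * c + h ^+ 2 / (2 * x) =
          (x - h) ^+ 2 / (2 * x) + h * (c + 1) + x / 2.
  by field; rewrite gt_eqF.
rewrite lerDr; apply: addr_ge0; last by apply: mulr_ge0 => //; lra.
by rewrite divr_ge0 ?sqr_ge0 // mulr_ge0 ?(ltW x0).
Qed.

(** * Bernstein basis polynomials on complex circles *)

(** Stated over any ring, so that one polynomial can be moved from [R] to [R[i]], where the Cauchy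
    estimate applies. *)
Definition bernstein_basis (R : nzRingType) (m k : nat) : {poly R} :=
  'C(m, k)%:R *: ('X^k * (1 - 'X) ^+ (m - k)).

Lemma horner_bernstein_basis (R : comNzRingType) (m k : nat) (x : R) :
  (bernstein_basis R m k).[x] = 'C(m, k)%:R * (x ^+ k * (1 - x) ^+ (m - k)).
Proof.
by rewrite hornerZ hornerM hornerXn horner_exp hornerD hornerN hornerX hornerC.
Qed.

Lemma size_bernstein_basis (R : idomainType) (m k : nat) :
  (k <= m)%N -> (size (bernstein_basis R m k) <= m.+1)%N.
Proof.
move=> km; apply: leq_trans (size_scale_leq _ _) _.
have s2 : size (1 - 'X : {poly R}) = 2%N.
  by rewrite -size_polyN opprB -polyC1 size_XsubC.
have n0 : (1 - 'X : {poly R}) != 0 by rewrite -size_poly_eq0 s2.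
rewrite size_mul ?expf_neq0 ?polyX_eq0 // size_polyXn.
have := size_exp (1 - 'X : {poly R}) (m - k); rewrite s2 mul1n.
by move: (size _) => s; lia.
Qed.

Lemma map_bernstein_basis (R S : nzRingType) (f : {rmorphism R -> S}) m k :
  map_poly f (bernstein_basis R m k) = bernstein_basis S m k.
Proof.
rewrite /bernstein_basis map_polyZ rmorphM !rmorphXn rmorphB rmorph1 /=.
by rewrite map_polyX rmorph_nat.
Qed.

Lemma map_nderivn (R S : nzRingType) (f : {rmorphism R -> S}) n (p : {poly R}) :
  map_poly f p^`N(n) = (map_poly f p)^`N(n).
Proof.
by apply/polyP => i; rewrite coef_map !coef_nderivn coef_map /= raddfMn.
Qed.

(** The contour points, hence the bounds [P j] for [|z|] and [T - P j] for [|1 - z|], do not depend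
    on [k]; this is what later allows summation over [k] under the average. *)
Lemma bernstein_basis_cauchy (R : rcfType) (m r : nat) (x h : R)
    (T := 1 + h ^+ 2 / (2 * x * (1 - x))) :
  0 < x < 1 -> 0 <= h ->
  exists (n : nat) (P : nat -> R),
    [/\ (0 < n)%N, forall j, x / 2 <= P j <= T - (1 - x) / 2 &
    forall k, (k <= m)%N -> `|(bernstein_basis R m k)^`N(r).[x]| * h ^+ r <=
      n%:R^-1 * \sum_(j < n) 'C(m, k)%:R * (P j ^+ k * (T - P j) ^+ (m - k))].
Proof.
move=> /andP[x0 x1] h0.
(* This order exceeds both the degree [m] of the basis and the order [r] of the derivative. *)
pose n := (m + r).+1; have n_gt0 : (0 < n)%N by [].
have [z pz] := prim_root_exists R[i] n_gt0.
have z1 j : `|z ^+ j| = 1 by rewrite normrX (normr_prim_root pz) expr1n.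
pose c j : R := complex.Re (z ^+ j).
have c1 j : `|c j| <= 1.
  by have := normc_ge_Re (z ^+ j); rewrite z1 -[1]/(1%:C)%C lecR.
pose P j := x + h * c j + h ^+ 2 / (2 * x).
have y0 : 0 < 1 - x by rewrite subr_gt0.
(* [T - P j] is [P j] with [x] replaced by [1 - x] and [c j] by [- c j], matching
   [1 - z = (1 - x) + h (- u)]; the same two lemmas then serve both factors. *)
have TP j : T - P j = (1 - x) + h * (- c j) + h ^+ 2 / (2 * (1 - x)).
  by rewrite /T /P; field; rewrite !gt_eqF.
exists n, P; split => // [j|k km].
  rewrite half_le_shift //= lerBrDl -lerBrDr TP half_le_shift //.
  by rewrite normrN.
have hr : (h%:C)%C \is Num.real by apply/complex_realP; exists h.
have := @cauchy_estimate R[i] n r z (x%:C)%C (h%:C)%C (bernstein_basis _ m k) pz.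
rewrite -(map_bernstein_basis (real_complex R)) -map_nderivn horner_map /=.
rewrite normc_def /= expr0n /= addr0 sqrtr_sqr -rmorphXn -rmorphM /=.
have shift_le (y d : R) (u : R[i]) : 0 < y -> `|u| = 1 -> complex.Re u = d ->
    `|y%:C%C + h%:C%C * u| <= (y + h * d + h ^+ 2 / (2 * y))%:C%C.
  move=> y_gt0 u1 <-; have yC : 0 < y%:C%C by rewrite ltcR.
  apply: le_trans (norm_shift_le yC hr u1) _.
  rewrite -complexRe !(rmorphD, rmorphM, rmorphXn, fmorphV) /=.
  by rewrite rmorph1.
move=> cauchy; rewrite -lecR; apply: le_trans (cauchy _ _ _) _.
- by rewrite map_bernstein_basis (leq_trans (size_bernstein_basis _ km)) ?ltnS ?leq_addr.
- by rewrite ltnS leq_addl.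
- by rewrite ler0c.
rewrite rmorphM fmorphV rmorph_nat /= ler_wpM2l ?invr_ge0 //.
rewrite rmorph_sum; apply: ler_sum => j _ /=.
rewrite map_bernstein_basis horner_bernstein_basis.
rewrite normrM normr_nat rmorphM rmorph_nat /= ler_wpM2l // normrM !normrX.
rewrite rmorphM !rmorphXn /= ler_pM ?exprn_ge0 //.
  apply: lerXn2r; rewrite ?nnegrE ?normr_ge0 //; last exact: shift_le.
  by apply: le_trans (shift_le _ _ _ _ (z1 j) _) => //.
have le1 : `|1 - (x%:C%C + h%:C%C * z ^+ j)| <= (T - P j)%:C%C.
  have -> : 1 - (x%:C%C + h%:C%C * z ^+ j) = (1 - x)%:C%C + h%:C%C * - z ^+ j.
    by rewrite rmorphB rmorph1 mulrN opprD addrA.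
  by rewrite TP; apply: shift_le; rewrite ?normrN ?raddfN.
by apply: lerXn2r; rewrite ?nnegrE ?normr_ge0 // (le_trans _ le1).
Qed.

(** * Binomial sums against reciprocal weights *)

(** Induction on [a]: the diagonal identity turns [(m+a+1) C(m+a,k+a)] into
    [(k+a+1) C(m+a+1,k+a+1)], and [k+a+1 <= (a+1)(k+1)]. *)
Lemma bin_ratio_le (m k a : nat) :
  ('C(m, k) * m ^ a <= a`! * 'C(m + a, k + a) * k.+1 ^ a)%N.
Proof.
elim: a => [|a IH]; first by rewrite !addn0 fact0 mul1n.
have H : ((m + a).+1 * 'C(m + a, k + a) = (k + a).+1 * 'C((m + a).+1, (k + a).+1))%N.
  by rewrite -mul_bin_diag.
rewrite !addnS factS !expnS.
apply: (@leq_trans (m * (a`! * 'C(m + a, k + a) * k.+1 ^ a))).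
  by rewrite mulnCA leq_mul2l IH orbT.
apply: (@leq_trans ((m + a).+1 * (a`! * 'C(m + a, k + a) * k.+1 ^ a))).
  by rewrite leq_mul2r; apply/orP; right; lia.
have -> : ((m + a).+1 * (a`! * 'C(m + a, k + a) * k.+1 ^ a) =
  a`! * k.+1 ^ a * ((m + a).+1 * 'C(m + a, k + a)))%N by ring.
rewrite H.
have -> : (a.+1 * a`! * 'C((m + a).+1, (k + a).+1) * (k.+1 * k.+1 ^ a) =
  a`! * k.+1 ^ a * (a.+1 * k.+1 * 'C((m + a).+1, (k + a).+1)))%N by ring.
by rewrite leq_mul2l leq_mul2r; apply/orP; right; apply/orP; right; lia.
Qed.

(** The factor [(m / (k+1))^a] shifts the index from [k] to [k + a], and [x <= 2 P] supplies the
    missing [P^a]. The result is part of the expansion of [(P + Q)^(m+a)], whose first [a] terms are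
    dropped. *)
Lemma sum_bernstein_ratio_le (R : realFieldType) (m a : nat) (x P Q : R) :
  0 < x -> x / 2 <= P -> 0 <= Q ->
  \sum_(k < m.+1) 'C(m, k)%:R * (P ^+ k * Q ^+ (m - k)) *
      (x * m%:R / k.+1%:R) ^+ a
    <= a`!%:R * 2 ^+ a * (P + Q) ^+ (m + a).
Proof.
move=> x0 xP Q0; have P0 : 0 < P by apply: lt_le_trans xP; rewrite divr_gt0.
pose G i := 'C(m + a, i)%:R * (P ^+ i * Q ^+ (m + a - i)).
have G0 i : 0 <= G i by rewrite !mulr_ge0 ?exprn_ge0 // ltW.
have -> : (P + Q) ^+ (m + a) = \sum_(i < a + m.+1) G i.
  rewrite addnS [(a + m)%N]addnC addrC exprDn; apply: eq_bigr => i _.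
  by rewrite /G mulr_natl [_ * P ^+ i]mulrC.
rewrite big_split_ord /= mulrDr ler_wpDl ?mulr_ge0 ?exprn_ge0 ?sumr_ge0 //.
rewrite mulr_sumr; apply: ler_sum => k _.
have km : (k <= m)%N by rewrite -ltnS.
rewrite /G [(a + k)%N]addnC subnDr exprD expr_div_n exprMn.
have k1 : 0 < k.+1%:R ^+ a :> R by rewrite exprn_gt0.
have B : 'C(m, k)%:R * m%:R ^+ a / k.+1%:R ^+ a
    <= a`!%:R * 'C(m + a, k + a)%:R :> R.
  by rewrite ler_pdivrMr // -!natrX -!natrM ler_nat bin_ratio_le.
have X : x ^+ a <= 2 ^+ a * P ^+ a.
  rewrite -exprMn lerXn2r ?nnegrE ?mulr_ge0 ?(ltW x0) ?(ltW P0) //; lra.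
have -> : 'C(m, k)%:R * (P ^+ k * Q ^+ (m - k)) *
   (x ^+ a * m%:R ^+ a / k.+1%:R ^+ a) =
   (P ^+ k * Q ^+ (m - k)) * (x ^+ a * ('C(m, k)%:R * m%:R ^+ a / k.+1%:R ^+ a)).
  by ring.
have -> : a`!%:R * 2 ^+ a *
   ('C(m + a, k + a)%:R * (P ^+ k * P ^+ a * Q ^+ (m - k))) =
   (P ^+ k * Q ^+ (m - k)) *
   ((2 ^+ a * P ^+ a) * (a`!%:R * 'C(m + a, k + a)%:R)) by ring.
rewrite ler_wpM2l ?mulr_ge0 ?exprn_ge0 ?(ltW P0) //.
by rewrite ler_pM ?exprn_ge0 ?(ltW x0) ?mulr_ge0 ?invr_ge0 ?exprn_ge0.
Qed.

(** The reflection [k -> m - k] exchanges [P] and [Q]. *)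
Lemma sum_bernstein_ratio_le_rev (R : realFieldType) (m a : nat) (y P Q : R) :
  0 < y -> y / 2 <= Q -> 0 <= P ->
  \sum_(k < m.+1) 'C(m, k)%:R * (P ^+ k * Q ^+ (m - k)) *
      (y * m%:R / (m - k).+1%:R) ^+ a
    <= a`!%:R * 2 ^+ a * (P + Q) ^+ (m + a).
Proof.
move=> y0 yQ P0; rewrite addrC.
apply: le_trans (sum_bernstein_ratio_le m a y0 yQ P0).
rewrite (reindex_inj rev_ord_inj) /=; apply: ler_sum => k _.
have km : (k <= m)%N by rewrite -ltnS.
by rewrite subSS bin_sub // subKn // [P ^+ _ * _]mulrC.
Qed.

Lemma expr_1D_le (R : realDomainType) (u : R) (a : nat) :
  0 <= u -> (1 + u) ^+ a <= 2 ^+ a * (1 + u ^+ a).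
Proof.
move=> u0; have [u1|u1] := leP u 1.
  apply: (@le_trans _ _ (2 ^+ a)); first by rewrite lerXn2r ?nnegrE //; lra.
  by rewrite ler_peMr ?exprn_ge0 // lerDl exprn_ge0.
apply: (@le_trans _ _ ((2 * u) ^+ a)); first by rewrite lerXn2r ?nnegrE //; lra.
by rewrite exprMn ler_wpM2l ?exprn_ge0 // lerDr.
Qed.

(* Up to constants, the reciprocal at k/m of a Jacobi weight with exponents at
   most a, relative to its value at x. *)
Definition weight_ratio (R : realFieldType) (a m k : nat) (x : R) : R :=
  (1 + x * m%:R / k.+1%:R) ^+ a + (1 + (1 - x) * m%:R / (m - k).+1%:R) ^+ a.

(** [2^a] comes from [expr_1D_le], 4 counts the sums it produces, each at most [a! 2^a T^(m+a)], and
    the exponential bounds [T^(m+a)]. *)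
Definition ratio_const (R : realType) (a : nat) : R :=
  2 ^+ a * (4 * (a`!%:R * 2 ^+ a)) * expR (1 + a%:R).

Lemma sum_weight_ratio_le (R : realType) (a m : nat) (x P T : R) :
  (0 < m)%N -> 0 < x < 1 -> T = 1 + (2 * m%:R)^-1 ->
  x / 2 <= P <= T - (1 - x) / 2 ->
  \sum_(k < m.+1) 'C(m, k)%:R * (P ^+ k * (T - P) ^+ (m - k)) *
    weight_ratio a m k x <= ratio_const R a.
Proof.
move=> m0 /andP[x0 x1] TE /andP[xP PT].
have mR : 1 <= m%:R :> R by rewrite ler1n.
have y0 : 0 < 1 - x by rewrite subr_gt0.
have P0 : 0 <= P by lra.
have yQ : (1 - x) / 2 <= T - P by lra.
have Q0 : 0 <= T - P by lra.
pose B k := 'C(m, k)%:R * (P ^+ k * (T - P) ^+ (m - k)).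
pose u k : R := x * m%:R / k.+1%:R.
pose v k : R := (1 - x) * m%:R / (m - k).+1%:R.
have u0 k : 0 <= u k by rewrite divr_ge0 // mulr_ge0 // ltW.
have v0 k : 0 <= v k by rewrite divr_ge0 // mulr_ge0 // ltW.
(* The constant terms are written [u k ^+ 0], so that the ratio lemma with exponent 0 covers
   them. *)
apply: (@le_trans _ _ (\sum_(k < m.+1)
    2 ^+ a * (B k * u k ^+ 0 + B k * u k ^+ 0 + B k * u k ^+ a + B k * v k ^+ a))).
  apply: ler_sum => k _; rewrite -!mulrDr [leRHS]mulrCA !expr0.
  rewrite ler_wpM2l ?mulr_ge0 ?exprn_ge0 //.
  have := expr_1D_le a (u0 k); have := expr_1D_le a (v0 k).
  rewrite /weight_ratio -/(u k) -/(v k); lra.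
rewrite -mulr_sumr !big_split /= /ratio_const -mulrA ler_wpM2l ?exprn_ge0 //.
have S0 := sum_bernstein_ratio_le m 0 x0 xP Q0.
have Su := sum_bernstein_ratio_le m a x0 xP Q0.
have Sv := sum_bernstein_ratio_le_rev m a y0 yQ P0.
rewrite -/B -/u -/v in S0 Su Sv.
have PQ : P + (T - P) = T by ring.
rewrite PQ addn0 fact0 expr0 !mul1r in S0; rewrite PQ in Su Sv.
have T1 : 1 <= T by rewrite TE lerDl invr_ge0 mulr_ge0.
have Tm : T ^+ m <= T ^+ (m + a) by rewrite ler_weXn2l // leq_addr.
have c1 : 1 <= a`!%:R * 2 ^+ a :> R.
  by rewrite -natrX -natrM ler1n muln_gt0 fact_gt0 expn_gt0.
(* From [1 + t <= e^t] the exponent is [(m + a) / (2m)], at most [1 + a] because [m >= 1]. *)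
have Te : T ^+ (m + a) <= expR (1 + a%:R).
  apply: (@le_trans _ _ (expR ((2 * m%:R)^-1) ^+ (m + a))).
    by rewrite lerXn2r ?nnegrE ?expR_ge0 ?(le_trans ler01) // TE expR_ge1Dx.
  rewrite -expRM_natl ler_expR natrD ler_pdivrMr ?mulr_gt0 ?ltr0n //.
  have := ler0n R a; nra.
have Tme : T ^+ (m + a) <= a`!%:R * 2 ^+ a * T ^+ (m + a).
  by rewrite ler_peMl // exprn_ge0 // (le_trans ler01).
have ce : a`!%:R * 2 ^+ a * T ^+ (m + a) <= a`!%:R * 2 ^+ a * expR (1 + a%:R).
  by rewrite ler_wpM2l // (le_trans ler01).
lra.
Qed.

(** With radius [h = sqrt (x (1-x) / m)] the excess of [T] over 1 is exactly [1 / (2m)]. After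
    exchanging the sums, every contour point obeys the same bound, hence so does their average. *)
Lemma sum_bernstein_basis_nderivn_le (R : realType) (a m r : nat) (x : R) :
  (0 < m)%N -> 0 < x < 1 ->
  Num.sqrt (x * (1 - x)) ^+ r *
    \sum_(k < m.+1) `|(bernstein_basis R m k)^`N(r).[x]| * weight_ratio a m k x
  <= ratio_const R a * Num.sqrt m%:R ^+ r.
Proof.
move=> m0 x01; have /andP[x0 x1] := x01.
have y0 : 0 < 1 - x by rewrite subr_gt0.
have mR : 0 < m%:R :> R by rewrite ltr0n.
pose h := Num.sqrt (x * (1 - x)) / Num.sqrt m%:R.
have sm0 : 0 < Num.sqrt m%:R :> R by rewrite sqrtr_gt0.
have h0 : 0 <= h by rewrite divr_ge0 ?sqrtr_ge0.
have h2 : h ^+ 2 = x * (1 - x) / m%:R.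
  by rewrite expr_div_n !sqr_sqrtr ?(ltW mR) // ltW // mulr_gt0.
have [n [P [n0 PT HP]]] := bernstein_basis_cauchy m r x01 h0.
have TE : 1 + h ^+ 2 / (2 * x * (1 - x)) = 1 + (2 * m%:R)^-1.
  by rewrite h2; field; rewrite !gt_eqF.
have -> : Num.sqrt (x * (1 - x)) = h * Num.sqrt m%:R.
  by rewrite /h divfK // gt_eqF.
rewrite exprMn -mulrA [ratio_const _ _ * _]mulrC mulrCA.
rewrite ler_wpM2l ?exprn_ge0 ?sqrtr_ge0 // mulr_sumr.
have wr0 k : 0 <= weight_ratio a m k x.
  by rewrite addr_ge0 // exprn_ge0 // addr_ge0 // divr_ge0 // mulr_ge0 // ltW.
apply: (@le_trans _ _ (\sum_(k < m.+1) (n%:R^-1 * \sum_(j < n) 'C(m, k)%:R *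
   (P j ^+ k * (1 + h ^+ 2 / (2 * x * (1 - x)) - P j) ^+ (m - k))) *
     weight_ratio a m k x)).
  apply: ler_sum => k _; rewrite mulrA [h ^+ r * _]mulrC.
  by rewrite ler_wpM2r // HP // -ltnS.
under eq_bigr do rewrite -mulrA mulr_suml.
rewrite -mulr_sumr exchange_big /= ler_pdivrMl ?ltr0n //.
rewrite [leRHS]mulr_natl -[n in leRHS]card_ord -sumr_const.
by apply: ler_sum => j _; apply: sum_weight_ratio_le.
Qed.

(** * Bounds drawn from [in_Cw] and [step_weight] *)

Lemma near_at_right (R : realType) (x : R) (A : set R) :
  (\forall y \near x^'+, A y) ->
  exists2 d, 0 < d & forall y, x < y < x + d -> A y.
Proof.
move=> [d /= d0 dA]; exists d => // y /andP[xy yd].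
by apply: dA => //=; rewrite ltr0_norm ?subr_lt0 //; lra.
Qed.

Lemma near_at_left (R : realType) (x : R) (A : set R) :
  (\forall y \near x^'-, A y) ->
  exists2 d, 0 < d & forall y, x - d < y < x -> A y.
Proof.
move=> [d /= d0 dA]; exists d => // y /andP[yd xy].
by apply: dA => //=; rewrite gtr0_norm ?subr_gt0 //; lra.
Qed.

(** The one-sided limits bound [g] near the ends; on the compact interval left over, [|g|] attains a
    maximum. *)
Lemma bounded_open_itv (R : realType) (g : R -> R) (l0 l1 : R) :
  {in `]0, 1[, continuous g} ->
  g x @[x --> 0^'+] --> l0 -> g x @[x --> 1^'-] --> l1 ->
  exists M, forall x, 0 < x < 1 -> `|g x| <= M.
Proof.
move=> cg g0 g1.
have e0 : `|l0| < `|l0| + 1 by rewrite ltrDl.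
have e1 : `|l1| < `|l1| + 1 by rewrite ltrDl.
have [d d0 Hd] := near_at_right (cvgr_norm_le _ g0 _ e0).
have [e e'0 He] := near_at_left (cvgr_norm_le _ g1 _ e1).
(* Halving [d] and [e] makes [[a, b]] overlap both end zones; the caps at [1 / 2] ensure
   [a <= b]. *)
pose a := Num.min (d / 2) (1 / 2); pose b := Num.max (1 - e / 2) (1 / 2).
have a0 : 0 < a by rewrite lt_min; lra.
have b1 : b < 1 by rewrite gt_max; lra.
have ad : a < d by rewrite gt_min; lra.
have be : 1 - e < b by rewrite lt_max; lra.
have ab : a <= b by rewrite ge_min [X in _ || X]le_max lexx !orbT.
have cab : {within `[a, b], continuous (fun x => `|g x|)}.
  apply: continuous_in_subspaceT => x; rewrite inE /= in_itv /= => /andP[ax xb].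
  apply: continuous_comp; last exact: norm_continuous.
  by apply: cg; rewrite in_itv /=; lra.
have [c _ Hc] := EVT_max ab cab.
exists (Num.max (Num.max (`|l0| + 1) (`|l1| + 1)) `|g c|) => x /andP[x0 x1].
rewrite !le_max.
have [xa|xa] := ltP x a; first by rewrite Hd //; lra.
have [xb|xb] := ltP b x; first by rewrite He ?orbT //; lra.
by rewrite Hc ?orbT // in_itv /= xa.
Qed.

Lemma continuous_jacobi_weight (R : realType) (alpha beta : R) :
  {in `]0, 1[, continuous (jacobi_weight alpha beta)}.
Proof.
move=> x; rewrite in_itv /= => /andP[x0 x1].
have cp (c z : R) : 0 < z -> {for z, continuous (fun u : R => u `^ c)}.
  move=> z0; apply/differentiable_continuous/derivable1_diffP.
  by apply: derivable_powR; rewrite in_itv /= z0.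
apply: (@continuousM _ _ (fun u : R => u `^ alpha)
  (fun u : R => (1 - u) `^ beta)); first exact: cp.
apply: (@continuous_comp _ _ _ (fun z : R => 1 - z) (fun u : R => u `^ beta)); last first.
  by apply: cp; rewrite subr_gt0.
by apply: continuousB; [exact: cst_continuous | exact: cvg_id].
Qed.

(** [sup] dominates its set only when the set is bounded above, which the continuity and the limits
    of [w f] guarantee. *)
Lemma ler_Cw_norm (R : realType) (alpha beta : R) (f : R -> R) (x : R) :
  in_Cw (jacobi_weight alpha beta) f -> 0 < x < 1 ->
  `|jacobi_weight alpha beta x * f x| <= Cw_norm (jacobi_weight alpha beta) f.
Proof.
move=> [cf f0 f1] x01; set w := jacobi_weight alpha beta in f0 f1 *.
have cwf : {in `]0, 1[, continuous (fun y => w y * f y)}.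
  move=> y y01; apply: (@continuousM _ _ w f); last exact: cf.
  exact: continuous_jacobi_weight.
have [M HM] := bounded_open_itv cwf f0 f1.
apply: ub_le_sup; last by exists x => //=; rewrite in_itv.
by exists M => _ [y /= + <-]; rewrite in_itv /= => /HM.
Qed.

(** Here [y] is the distance to the nearer end. As [y <= 1] and [b >= 1/2], [y^b <= sqrt y]; as
    [1 - y >= 1/2], [sqrt y <= 2 sqrt (y (1-y))]. *)
Lemma step_weight_end_le (R : realType) (C b y p : R) :
  0 < C -> 2^-1 <= b -> 0 < y <= 2^-1 -> C^-1 * y `^ b <= p <= C * y `^ b ->
  `|p| <= 2 * C * Num.sqrt (y * (1 - y)).
Proof.
move=> C0 b2 /andP[y0 y2] /andP[p1 p2].
rewrite ger0_norm; last by apply: le_trans p1; rewrite mulr_ge0 ?powR_ge0 ?invr_ge0 ?ltW.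
apply: (le_trans p2); rewrite [2 * C]mulrC -mulrA ler_wpM2l ?(ltW C0) //.
apply: (@le_trans _ _ (y `^ 2^-1)).
  by rewrite /powR gt_eqF // ler_expR ler_wnM2r ?ln_le0 //; lra.
rewrite powR12_sqrt ?(ltW y0) // -[leLHS]ger0_norm ?sqrtr_ge0 //.
have -> : 2 = Num.sqrt (2 ^+ 2) :> R by rewrite sqrtr_sqr ger0_norm.
rewrite -sqrtrM ?sqr_ge0 // ger0_norm ?sqrtr_ge0 // ler_sqrt; nra.
Qed.

Lemma step_weight_le_sqrt (R : realType) (phi : R -> R) (b0 b1 : R) :
  step_weight phi b0 b1 -> 2^-1 <= Num.min b0 b1 ->
  exists2 M, 0 < M &
    forall x, 0 < x < 1 -> `|phi x| <= M * Num.sqrt (x * (1 - x)).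
Proof.
move=> [pb _ _ p0 p1]; rewrite le_min => /andP[hb0 hb1].
have [C C0 /near_at_right[d d0 Hd]] := p0.
have [D D0 /near_at_left[e e0 He]] := p1.
pose a := Num.min (d / 2) (1 / 2); pose b := Num.max (1 - e / 2) (1 / 2).
have a0 : 0 < a by rewrite lt_min; lra.
have a2 : a <= 1 / 2 by rewrite ge_min lexx orbT.
have b1' : b < 1 by rewrite gt_max; lra.
have b2 : 1 / 2 <= b by rewrite le_max lexx orbT.
have ad : a < d by rewrite gt_min; lra.
have be : 1 - e < b by rewrite lt_max; lra.
have [N N0 HN] := pb a b a0 (le_trans a2 b2) b1'.
(* On [[a, b]], [s] bounds [sqrt (x (1-x))] from below, so [N / s] turns the constant bound [N] into
   the required form. *)
pose s := Num.sqrt (a * (1 - b)).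
have s0 : 0 < s by rewrite sqrtr_gt0 mulr_gt0 // subr_gt0.
have Ns : 0 < N / s by rewrite divr_gt0.
exists (2 * C + 2 * D + N / s) => [|x /andP[x0 x1]]; first lra.
have q0 := sqrtr_ge0 (x * (1 - x)).
have [xa|xa] := ltP x a.
  have := step_weight_end_le C0 hb0 (_ : 0 < x <= 2^-1) (Hd x _).
  move=> /(_ ltac:(lra) ltac:(lra)) /le_trans; apply.
  by rewrite ler_wpM2r //; lra.
have [xb|xb] := ltP b x.
  have := step_weight_end_le D0 hb1 (_ : 0 < 1 - x <= 2^-1) (He x _).
  move=> /(_ ltac:(lra) ltac:(lra)); rewrite subKr [(1 - x) * x]mulrC.
  by move=> /le_trans; apply; rewrite ler_wpM2r //; lra.
have /HN/andP[phi1 phi2] : a <= x <= b by rewrite xa.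
have N1 : 0 < N^-1 by rewrite invr_gt0.
rewrite ger0_norm; last lra.
have ss : s <= Num.sqrt (x * (1 - x)) by rewrite ler_wsqrtr //; nra.
apply: (le_trans phi2); apply: (@le_trans _ _ (N / s * s)).
  by rewrite divfK // gt_eqF.
apply: (@le_trans _ _ (N / s * Num.sqrt (x * (1 - x)))).
  by rewrite ler_wpM2l // ltW.
by rewrite ler_wpM2r //; lra.
Qed.

(** * Weighted values of the modified function at the nodes [k / m] *)

(** Each factor of a Lagrange basis polynomial is at most [B d / d]; as [B >= 1], the omitted factor
    [j = i] may also be counted as [B]. *)
Lemma lagrange_interp_le (R : realType) (r : nat) (t : nat -> R) (f : R -> R)
    (y c d B V : R) :
  0 < d -> 1 <= B -> 0 <= c -> 0 <= V ->
  (forall i, (1 <= i <= r)%N -> c * `|f (t i)| <= V) ->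
  (forall i, (1 <= i <= r)%N -> `|y - t i| <= B * d) ->
  (forall i j, i != j -> d <= `|t i - t j|) ->
  c * `|lagrange_interp r t f y| <= r%:R * (B ^+ r * V).
Proof.
move=> d0 B1 c0 V0 fV yt tt.
have B0 : 0 <= B := le_trans ler01 B1.
apply: (@le_trans _ _ (\sum_(1 <= i < r.+1) (B ^+ r * V))); last first.
  by rewrite sumr_const_nat subSS subn0 mulr_natl.
apply: le_trans (ler_wpM2l c0 (ler_norm_sum _ _ _)) _.
rewrite mulr_sumr; apply: ler_sum_nat => i; rewrite ltnS => ir.
rewrite normrM mulrA mulrC ler_pM ?mulr_ge0 ?fV //.
rewrite normr_prod big_mkcond /= -[leRHS](_ : \prod_(1 <= j < r.+1) B = _); last first.
  by rewrite prodr_const_nat subSS subn0.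
rewrite big_nat [leRHS]big_nat; apply: ler_prod => j; rewrite ltnS => jr.
case: ifP => [ji|_]; last by rewrite ler01.
rewrite normr_ge0 normrM normfV /= ler_pdivrMr.
  by apply: le_trans (yt _ jr) _; rewrite ler_wpM2l // tt // eq_sym.
by apply: lt_le_trans d0 (tt _ _ _); rewrite eq_sym.
Qed.

(** The base is raised to [1 + t >= 1] before the exponent is increased, since [t] itself may be
    below 1. *)
Lemma powR_le_expr_1D (R : realType) (t al : R) (a : nat) :
  0 <= t -> 0 <= al <= a%:R -> t `^ al <= (1 + t) ^+ a.
Proof.
move=> t0 /andP[al0 ala]; rewrite -powR_mulrn ?addr_ge0 //.
apply: (@le_trans _ _ ((1 + t) `^ al)).
  by rewrite ge0_ler_powR ?nnegrE ?addr_ge0 ?lerDr.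
by rewrite ler_powR // lerDl.
Qed.

Lemma ler1_dist_natr (R : realDomainType) (i j : nat) :
  i != j -> 1 <= `|i%:R - j%:R| :> R.
Proof.
wlog ij : i j / (i < j)%N => [H|_].
  by rewrite neq_ltn => /orP[|] ij; [|rewrite distrC]; rewrite H // ltn_eqF.
by rewrite distrC ger0_norm ?subr_ge0 ?ler_nat 1?ltnW // -natrB 1?ltnW // ler1n subn_gt0.
Qed.

Section Bounds.
Context (R : realType) (alpha beta : R) (a : nat).
Context (ha : 0 <= alpha <= a%:R) (hb : 0 <= beta <= a%:R).
Let w := jacobi_weight alpha beta.

Lemma jacobi_weight_ge0 (x : R) : 0 <= w x.
Proof. by rewrite mulr_ge0 ?powR_ge0. Qed.

Lemma jacobi_weight_le (x y : R) : 0 < x < 1 -> 0 < y < 1 ->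
  w x <= w y * ((1 + x / y) ^+ a * (1 + (1 - x) / (1 - y)) ^+ a).
Proof.
have P (u v c : R) : 0 < u -> 0 < v -> 0 <= c <= a%:R ->
    u `^ c <= v `^ c * (1 + u / v) ^+ a.
  move=> u0 v0 hc; rewrite -{1}(divfK (lt0r_neq0 v0) u) mulrC.
  have uv : 0 <= u / v by rewrite divr_ge0 ?ltW.
  by rewrite powRM ?(ltW v0) // ler_wpM2l ?powR_ge0 // powR_le_expr_1D.
move=> /andP[x0 x1] /andP[y0 y1]; rewrite /w /jacobi_weight mulrACA.
by rewrite ler_pM ?powR_ge0 // P ?subr_gt0.
Qed.

Context (f : R -> R).
Context (hf : in_Cw w f).
Let N := Cw_norm w f.

Lemma Cw_norm_ge0 : 0 <= N.
Proof.
have h : 0 < (2^-1 : R) < 1 by lra.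
exact: le_trans (ler_Cw_norm hf h).
Qed.

(** [w y |f y|] is at most the norm, and moving the weight from [y] to [x] costs only the two ratios
    of distances to the ends. *)
Lemma jacobi_weight_mul_le (x y u v : R) : 0 < x < 1 -> 0 < y < 1 ->
  x / y <= u -> (1 - x) / (1 - y) <= v ->
  w x * `|f y| <= N * ((1 + u) * (1 + v)) ^+ a.
Proof.
move=> x01 y01 xu xv; have /andP[x0 x1] := x01; have /andP[y0 y1] := y01.
have h0 : 0 <= (1 + x / y) * (1 + (1 - x) / (1 - y)).
  by rewrite mulr_ge0 // addr_ge0 // divr_ge0 // ?subr_ge0 ltW.
apply: (@le_trans _ _ (w y * `|f y| * ((1 + x / y) * (1 + (1 - x) / (1 - y))) ^+ a)).
  by rewrite exprMn [leRHS]mulrAC ler_wpM2r // jacobi_weight_le.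
have wf : w y * `|f y| <= N.
  by rewrite -[w y]ger0_norm ?jacobi_weight_ge0 // -normrM ler_Cw_norm.
apply: ler_pM => //; first by rewrite mulr_ge0 ?jacobi_weight_ge0.
  exact: exprn_ge0.
have q0 : 0 <= x / y by rewrite divr_ge0 ?ltW.
have q1 : 0 <= (1 - x) / (1 - y) by rewrite divr_ge0 ?subr_ge0 ?ltW.
have uv : (1 + x / y) * (1 + (1 - x) / (1 - y)) <= (1 + u) * (1 + v).
  by rewrite ler_pM ?addr_ge0 ?lerD2l.
by rewrite lerXn2r ?nnegrE // (le_trans h0).
Qed.

Context (r n m k : nat) (x : R).
Context (hn : (maxn r 3 < n)%N) (hnm : (n <= m)%N) (hk : (k <= m)%N).
Context (hx : 0 < x < 1).
Let y : R := k%:R / m%:R.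
(** [r (r+2)^r] comes from the Lagrange sum and [(3 (r+2))^a] from comparing the weight at [x] with
    that at the interpolation points. *)
Let D : R := r%:R * (r%:R + 2) ^+ r * (3 * (r%:R + 2)) ^+ a.

Lemma weight_ratio_gel : (1 + x * m%:R / k.+1%:R) ^+ a <= weight_ratio a m k x.
Proof.
have /andP[x0 x1] := hx.
by rewrite lerDl exprn_ge0 // addr_ge0 // divr_ge0 // mulr_ge0 // subr_ge0 ltW.
Qed.

Lemma weight_ratio_ger :
  (1 + (1 - x) * m%:R / (m - k).+1%:R) ^+ a <= weight_ratio a m k x.
Proof.
have /andP[x0 x1] := hx.
by rewrite lerDr exprn_ge0 // addr_ge0 // divr_ge0 // mulr_ge0 // ltW.
Qed.

Let rn : (r < n)%N. Proof. by apply: leq_ltn_trans hn; rewrite leq_maxl. Qed.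
Let nR : 0 < n%:R :> R. Proof. by rewrite ltr0n; lia. Qed.
Let mR : 0 < m%:R :> R. Proof. by rewrite ltr0n; lia. Qed.

(** [j + 1 <= 2 j] for [j >= 1]; the shifted denominator keeps [weight_ratio] meaningful at the end
    nodes too. *)
Lemma ratio_half_shift (z : R) (j : nat) : 0 <= z -> (0 < j)%N ->
  z / (j%:R / m%:R) <= 2 * (z * m%:R / j.+1%:R).
Proof.
move=> z0 j0; have jR : 1 <= j%:R :> R by rewrite ler1n.
have -> : z / (j%:R / m%:R) = z * m%:R / j%:R.
  by field; rewrite !gt_eqF // (lt_le_trans ltr01).
rewrite mulrCA ler_wpM2l ?mulr_ge0 // ler_pdivlMr ?ltr0n // mulrC.
by rewrite ler_pdivrMr ?(lt_le_trans ltr01) // -natr1; lra.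
Qed.

Lemma one_sub_node : 1 - y = (m - k)%:R / m%:R.
Proof. by rewrite /y natrB // mulrBl divff // gt_eqF. Qed.

(** The ratio at the end farther from [y] is at most 2, so the product is at most
    [3 (1 + 2u) <= 6 (1 + u)], with [u] the ratio at the nearer end. *)
Lemma interior_value_le : 0 < y < 1 ->
  w x * `|f y| <= 6 ^+ a * (N * weight_ratio a m k x).
Proof.
move=> y01; have /andP[y0 y1] := y01; have /andP[x0 x1] := hx.
have x0' : 0 <= 1 - x by lra.
have k0 : (0 < k)%N.
  by rewrite lt0n; apply: contraTN y0 => /eqP k_eq0; rewrite /y k_eq0 mul0r ltxx.
have km : (0 < m - k)%N.
  rewrite -(ltr0n R); have : 0 < 1 - y by lra.
  by rewrite one_sub_node pmulr_lgt0 ?invr_gt0.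
have Hx := ratio_half_shift (ltW x0) k0.
have Hx' := ratio_half_shift x0' km.
rewrite -/y in Hx; rewrite -one_sub_node in Hx'.
set u := x * m%:R / k.+1%:R in Hx; set v := (1 - x) * m%:R / (m - k).+1%:R in Hx'.
have u0 : 0 <= u by rewrite divr_ge0 // mulr_ge0 // ltW.
have v0 : 0 <= v by rewrite divr_ge0 // mulr_ge0.
have [yh|yh] := leP y 2^-1.
  have E : (1 - x) / (1 - y) <= 2 by rewrite ler_pdivrMr; lra.
  apply: le_trans (jacobi_weight_mul_le hx y01 Hx E) _.
  rewrite [leRHS]mulrCA ler_wpM2l ?Cw_norm_ge0 //.
  apply: (@le_trans _ _ (6 ^+ a * (1 + u) ^+ a)).
    by rewrite -exprMn lerXn2r ?nnegrE; nra.
  by rewrite ler_wpM2l ?exprn_ge0 // weight_ratio_gel.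
have E : x / y <= 2 by rewrite ler_pdivrMr; lra.
apply: le_trans (jacobi_weight_mul_le hx y01 E Hx') _.
rewrite [leRHS]mulrCA ler_wpM2l ?Cw_norm_ge0 //.
apply: (@le_trans _ _ (6 ^+ a * (1 + v) ^+ a)).
  by rewrite -exprMn lerXn2r ?nnegrE; nra.
by rewrite ler_wpM2l ?exprn_ge0 // weight_ratio_ger.
Qed.

(** A node within [2 / n] of an end satisfies [n (j + 1) <= 2m + n <= 3m], as [n <= m]. *)
Lemma near_end_scale (z : R) (j : nat) : 0 <= z -> (j * n <= 2 * m)%N ->
  1 + z * n%:R <= 3 * (1 + z * m%:R / j.+1%:R).
Proof.
move=> z0 jn; have j0 : 0 < j.+1%:R :> R by rewrite ltr0n.
have H : n%:R <= 3 * (m%:R / j.+1%:R) :> R.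
  rewrite mulrA ler_pdivlMr // -!natrM ler_nat mulnS mulnC.
  by rewrite (mulSn 2 m) leq_add.
have E : z * (3 * (m%:R / j.+1%:R)) = 3 * (z * m%:R / j.+1%:R) by ring.
by have := ler_wpM2l z0 H; rewrite E; move: (z * m%:R / _) => q; lra.
Qed.

(** Shared by both ends: [z = x], [j = k] on the left, and [z = 1 - x], [j = m - k] on the right. *)
Lemma interp_const_le (z W : R) (j : nat) : 0 <= z -> (j * n <= 2 * m)%N ->
  (1 + z * m%:R / j.+1%:R) ^+ a <= W ->
  r%:R * ((r%:R + 2) ^+ r * (N * ((1 + z * n%:R) * (r%:R + 2)) ^+ a))
    <= D * (N * W).
Proof.
move=> z0 jn HW; have r2 : 0 <= r%:R + 2 :> R by rewrite addr_ge0.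
rewrite /D -!mulrA ler_wpM2l // ler_wpM2l ?exprn_ge0 //.
rewrite [leRHS]mulrCA ler_wpM2l ?Cw_norm_ge0 //.
apply: (@le_trans _ _ ((3 * (r%:R + 2)) ^+ a *
    (1 + z * m%:R / j.+1%:R) ^+ a)); last first.
  by rewrite ler_wpM2l // exprn_ge0 // mulr_ge0.
rewrite -exprMn mulrAC lerXn2r ?nnegrE ?mulr_ge0 ?addr_ge0 ?mulr_ge0 ?invr_ge0 //.
by rewrite ler_wpM2r // near_end_scale.
Qed.

(** As [i >= 1], the distance of [i / n] from 0 is at least [1 / n]; as [i <= r] and [n >= r + 1],
    its distance from 1 is at least [1 / (r + 1)]. *)
Lemma node_value_le (i : nat) : (1 <= i <= r)%N ->
  [/\ 0 < (i%:R / n%:R : R) < 1,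
      forall z : R, 0 <= z -> z / (i%:R / n%:R) <= z * n%:R &
      forall z : R, 0 <= z <= 1 -> z / (1 - i%:R / n%:R) <= r%:R + 1].
Proof.
move=> /andP[i0 ir]; have iR : 1 <= i%:R :> R by rewrite ler1n.
have i_gt0 := lt_le_trans ltr01 iR.
have irR : i%:R <= r%:R :> R by rewrite ler_nat.
have rnR : r%:R + 1 <= n%:R :> R by rewrite natr1 ler_nat.
have ln : i%:R / n%:R < 1 :> R by rewrite ltr_pdivrMr // mul1r; lra.
split=> [|z z0|z /andP[z0 z1]].
- by rewrite divr_gt0.
- by rewrite invf_div mulrA ler_pdivrMr // ler_peMr // mulr_ge0 // ltW.
have E : 1 - i%:R / n%:R = (n%:R - i%:R) / n%:R :> R.
  by rewrite mulrBl divff // gt_eqF.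
rewrite ler_pdivrMr ?subr_gt0 // E mulrA ler_pdivlMr //.
by have := ler0n R r; nra.
Qed.

Lemma left_interp_value_le : y <= 2 / n%:R ->
  w x * `|left_interp r n f y| <= D * (N * weight_ratio a m k x).
Proof.
move=> y2; have /andP[x0 x1] := hx.
have y0 : 0 <= y by rewrite divr_ge0.
have kn : (k * n <= 2 * m)%N.
  by move: y2; rewrite ler_pdivrMr // mulrAC ler_pdivlMr // -!natrM ler_nat.
apply: le_trans (interp_const_le (ltW x0) kn weight_ratio_gel).
(* The spacing is [1 / n]; with [y] in [[0, 2/n]] and the points in [[0, r/n]], all distances are at
   most [(r + 2) / n]. *)
apply: (@lagrange_interp_le _ _ _ _ _ _ n%:R^-1).
- by rewrite invr_gt0.
- by have := ler0n R r; lra.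
- exact: jacobi_weight_ge0.
- by rewrite mulr_ge0 ?Cw_norm_ge0 // exprn_ge0 // !(mulr_ge0, addr_ge0) // ltW.
- move=> i /node_value_le[in01 Hl Hr].
  have -> : r%:R + 2 = 1 + (r%:R + 1) :> R by ring.
  by apply: jacobi_weight_mul_le => //; [apply: Hl | apply: Hr]; lra.
- move=> i /andP[i0 ir]; rewrite ler_norml.
  have irR : i%:R / n%:R <= r%:R / n%:R :> R by rewrite ler_wpM2r ?invr_ge0 ?ler_nat // ltW.
  have i0R : 0 <= i%:R / n%:R :> R by rewrite divr_ge0.
  have r0R : 0 <= r%:R / n%:R :> R by rewrite divr_ge0.
  by rewrite mulrDl; lra.
move=> i j ij; rewrite -mulrBl normrM [`|n%:R^-1|]ger0_norm ?invr_ge0 //.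
by rewrite ler_peMl ?invr_ge0 // ler1_dist_natr.
Qed.

Lemma right_interp_value_le : 1 - 2 / n%:R <= y ->
  w x * `|right_interp r n f y| <= D * (N * weight_ratio a m k x).
Proof.
move=> y2; have /andP[x0 x1] := hx.
have x0' : 0 <= 1 - x by lra.
have y1 : 0 <= 1 - y by rewrite one_sub_node divr_ge0.
have kn : ((m - k) * n <= 2 * m)%N.
  have : 1 - y <= 2 / n%:R by lra.
  by rewrite one_sub_node ler_pdivrMr // mulrAC ler_pdivlMr // -!natrM ler_nat.
apply: le_trans (interp_const_le x0' kn weight_ratio_ger).
apply: (@lagrange_interp_le _ _ _ _ _ _ n%:R^-1).
- by rewrite invr_gt0.
- by have := ler0n R r; lra.
- exact: jacobi_weight_ge0.
- by rewrite mulr_ge0 ?Cw_norm_ge0 // exprn_ge0 // mulr_ge0 // addr_ge0 // mulr_ge0 // ltW.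
- move=> i /node_value_le[in01 Hl Hr].
  have -> : r%:R + 2 = 1 + (r%:R + 1) :> R by ring.
  rewrite [(1 + (1 - x) * _) * _]mulrC.
  apply: jacobi_weight_mul_le; rewrite ?subKr //; first lra.
    by apply: Hr; lra.
  exact: Hl.
- move=> i /andP[i0 ir]; rewrite ler_norml.
  have irR : i%:R / n%:R <= r%:R / n%:R :> R by rewrite ler_wpM2r ?invr_ge0 ?ler_nat // ltW.
  have i0R : 0 <= i%:R / n%:R :> R by rewrite divr_ge0.
  have r0R : 0 <= r%:R / n%:R :> R by rewrite divr_ge0.
  by rewrite mulrDl; lra.
move=> i j ij.
have -> : 1 - i%:R / n%:R - (1 - j%:R / n%:R) = (j%:R - i%:R) / n%:R :> R by ring.
rewrite normrM [`|n%:R^-1|]ger0_norm ?invr_ge0 //.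
by rewrite ler_peMl ?invr_ge0 // ler1_dist_natr // eq_sym.
Qed.

Lemma blend_le (p s t A B : R) : 0 <= p <= 1 ->
  w x * `|s| <= A -> w x * `|t| <= B ->
  w x * `|(1 - p) * s + p * t| <= A + B.
Proof.
move=> /andP[p0 p1] sA tB; have w0 := jacobi_weight_ge0 x.
apply: (@le_trans _ _ (w x * `|s| + w x * `|t|)); last exact: lerD.
rewrite -mulrDr ler_wpM2l // (le_trans (ler_normD _ _)) //.
rewrite !normrM (ger0_norm p0) [`|1 - p|]ger0_norm ?subr_ge0 //.
by rewrite lerD // ler_piMl // gerBl.
Qed.

(** Interpolating branches contribute [D], branches using [f] contribute [6^a], and the two blends,
    being convex combinations, contribute at most the sum. *)
Lemma modified_value_le (psi : R -> R) : smooth_step psi ->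
  w x * `|modified psi r n f y| <= (D + 6 ^+ a) * (N * weight_ratio a m k x).
Proof.
move=> hpsi; rewrite mulrDl.
have psi01 t : 0 <= psi t <= 1.
  have mono := smooth_step_nondecreasing hpsi.
  have [t0|t0] := leP t 0.
    by rewrite (smooth_step_left hpsi) // lexx ler01.
  have [t1|t1] := leP 1 t.
    by rewrite (smooth_step_right hpsi) // lexx ler01.
  rewrite -{1}(smooth_step_left hpsi (lexx 0)) -(smooth_step_right hpsi (lexx 1)).
  by rewrite !mono // ltW.
have W0 : 0 <= weight_ratio a m k x.
  apply: le_trans weight_ratio_gel; have /andP[x0 x1] := hx.
  by rewrite exprn_ge0 // addr_ge0 // divr_ge0 // mulr_ge0 // ltW.
have NW0 : 0 <= N * weight_ratio a m k x by rewrite mulr_ge0 // Cw_norm_ge0.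
have D0 : 0 <= D by rewrite !(mulr_ge0, exprn_ge0, addr_ge0).
have DN0 : 0 <= D * (N * weight_ratio a m k x) by rewrite mulr_ge0.
have SN0 : 0 <= 6 ^+ a * (N * weight_ratio a m k x) by rewrite mulr_ge0 // exprn_ge0.
(* With [n >= 4], [y] lies in []0, 1[] on every branch that evaluates [f] at [y]. *)
have n4 : 4 <= n%:R :> R.
  by rewrite ler_nat; apply: leq_trans hn; rewrite ltnS leq_maxr.
have [n1 n2] : 0 < n%:R^-1 :> R /\ n%:R^-1 <= 4^-1 :> R.
  by rewrite invr_gt0 lef_pV2 ?posrE.
rewrite /modified /= div1r; case: ifP => [y1|/negbT]; last rewrite -ltNge => y1.
  by apply: ler_wpDr => //; apply: left_interp_value_le; lra.
case: ifP => [y2|/negbT]; last rewrite -ltNge => y2.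
  apply: blend_le => //; first exact: left_interp_value_le.
  by apply: interior_value_le; lra.
case: ifP => [y3|/negbT]; last rewrite -ltNge => y3.
  by apply: ler_wpDl => //; apply: interior_value_le; lra.
case: ifP => [y4|/negbT]; last rewrite -ltNge => y4.
  apply: blend_le => //; first by apply: right_interp_value_le; lra.
  by apply: interior_value_le; lra.
by apply: ler_wpDr => //; apply: right_interp_value_le; lra.
Qed.

End Bounds.

(** * Derivatives of the combination and the final estimate *)

Lemma derive1n_horner (R : realType) (r : nat) (p : {poly R}) :
  derive1n r (horner p) = horner p^`(r).
Proof. by elim: r => [//|r IH]; rewrite derive1nS IH -derivE -derivnS. Qed.

Lemma bernstein_horner (R : realType) (m : nat) (g : R -> R) :
  bernstein m g =
  horner (\sum_(k < m.+1) g (k%:R / m%:R) *: bernstein_basis R m k).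
Proof.
apply/funext => x; rewrite horner_sum; apply: eq_bigr => k _.
by rewrite hornerZ horner_bernstein_basis !mulrA.
Qed.

(** The combination is a polynomial for any [g], so its derivative is the formal one; the factor
    [r!] converts the Taylor-normalised derivative. *)
Lemma derive1n_bernstein_comb (R : realType) (nodes : nat -> nat -> nat)
    (coef : nat -> nat -> R) (n s r : nat) (g : R -> R) (x : R) :
  derive1n r (bernstein_comb nodes coef n s g) x =
  \sum_(i < s) coef n i *
    (\sum_(k < (nodes n i).+1) g (k%:R / (nodes n i)%:R) *
       (bernstein_basis R (nodes n i) k)^`N(r).[x]) *+ r`!.
Proof.
have -> : bernstein_comb nodes coef n s g =
    horner (\sum_(i < s) coef n i *: \sum_(k < (nodes n i).+1)
      g (k%:R / (nodes n i)%:R) *: bernstein_basis R (nodes n i) k).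
  apply/funext => z; rewrite horner_sum; apply: eq_bigr => i _.
  by rewrite hornerZ bernstein_horner.
rewrite derive1n_horner nderivn_def hornerMn linear_sum horner_sum -sumrMnl.
apply: eq_bigr => i _; congr (_ *+ _); rewrite linearZ hornerZ; congr (_ * _).
by rewrite linear_sum horner_sum; apply: eq_bigr => k _; rewrite linearZ hornerZ.
Qed.

Lemma scheme_nodes_bounds (R : realType) (s n i : nat) (K : R)
    (nodes : nat -> nat -> nat) (coef : nat -> nat -> R) :
  bernstein_scheme s K nodes coef -> (0 < n)%N -> (i < s)%N ->
  (n <= nodes n i)%N /\ (nodes n i)%:R <= K * n%:R.
Proof.
move=> h n0; have mono j : (i + j < s)%N -> (nodes n i <= nodes n (i + j))%N.
  elim: j => [|j IH]; first by rewrite addn0.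
  rewrite addnS => js; apply: leq_trans (IH (ltnW js)) _.
  by rewrite ltnW // (scheme_incr h).
move=> is_; split.
  elim: i is_ {mono} => [|i IH] is_; first by rewrite (scheme_first h).
  by apply: leq_trans (IH (ltnW is_)) _; rewrite ltnW // (scheme_incr h).
apply: le_trans (scheme_last h n0); rewrite ler_nat.
have -> : s.-1 = (i + (s.-1 - i))%N by lia.
by apply: mono; lia.
Qed.

Lemma powR_half_natr (R : realType) (r n : nat) :
  n%:R `^ (r%:R / 2) = Num.sqrt n%:R ^+ r :> R.
Proof. by rewrite mulrC powRrM powR_mulrn ?powR_ge0 // powR12_sqrt. Qed.

Theorem theorem2p1 (R : realType) (r : nat) (alpha beta : R)
    (phi : R -> R) (b0 b1 : R) (psi : R -> R) (K : R)
    (hr : (2 <= r)%N) (halpha : 0 < alpha) (hbeta : 0 < beta)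
    (hphi : step_weight phi b0 b1) (hb : 2^-1 <= Num.min b0 b1)
    (hpsi : smooth_step psi) :
  exists2 C : R, 0 < C &
    forall (nodes : nat -> nat -> nat) (coef : nat -> nat -> R),
      bernstein_scheme r.-1 K nodes coef ->
    forall (f : R -> R), in_Cw (jacobi_weight alpha beta) f ->
    forall n : nat, (maxn r 3 < n)%N ->
    forall x : R, 0 <= x <= 1 ->
      `|jacobi_weight alpha beta x * phi x ^+ r
          * derive1n r (bernstein_star psi nodes coef r n f) x|
        <= C * n%:R `^ (r%:R / 2) * Cw_norm (jacobi_weight alpha beta) f.
Proof.
have [M M0 phiM] := step_weight_le_sqrt hphi hb.
(* One integer above both exponents, as both are positive. *)
pose a := Num.bound (alpha + beta).
have hab : alpha + beta < a%:R by rewrite archi_boundP // addr_ge0 ?ltW.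
have ha : 0 <= alpha <= a%:R by lra.
have hb' : 0 <= beta <= a%:R by lra.
pose D : R := r%:R * (r%:R + 2) ^+ r * (3 * (r%:R + 2)) ^+ a + 6 ^+ a.
have D0 : 0 < D.
  by rewrite ltr_wpDl ?exprn_gt0 // !(mulr_ge0, exprn_ge0, addr_ge0).
(* The constant must be positive before any scheme is given, while [K] is an arbitrary real. *)
pose L := `|K| + 1; have L0 : 0 < L by rewrite ltr_wpDl.
have KL : K <= L by rewrite /L; have := ler_norm K; lra.
have A0 : 0 < ratio_const R a.
  by rewrite !mulr_gt0 ?exprn_gt0 ?expR_gt0 //.
(* In order: the values of [F], [phi^r], the basis sum, the passage from [m] to [L n], and the
   normalisation of the derivative. *)
pose E := D * M ^+ r * ratio_const R a * Num.sqrt L ^+ r * r`!%:R.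
have E0 : 0 < E.
  by rewrite /E !mulr_gt0 ?exprn_gt0 ?sqrtr_gt0 // ltr0n fact_gt0.
exists (L * E) => [|nodes coef hs f hf n hn x /andP[x0 x1]]; first exact: mulr_gt0.
set w := jacobi_weight alpha beta; set N := Cw_norm w f.
have N0 : 0 <= N := Cw_norm_ge0 hf.
rewrite powR_half_natr.
have rhs0 : 0 <= L * E * Num.sqrt n%:R ^+ r * N.
  by rewrite mulr_ge0 // mulr_ge0 ?exprn_ge0 ?sqrtr_ge0 // ltW // mulr_gt0.
(* At the end points the weight vanishes, because 0 to a nonzero power is 0; the contour argument
   covers the open interval. *)
have [x00|x_neq0] := eqVneq x 0.
  by rewrite /w /jacobi_weight x00 powR0 ?gt_eqF // !mul0r normr0.
have [x11|x_neq1] := eqVneq x 1.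
  by rewrite /w /jacobi_weight x11 subrr [0 `^ beta]powR0 ?gt_eqF // mulr0 !mul0r normr0.
have x01 : 0 < x < 1 by rewrite !lt_neqAle eq_sym x_neq0 x0 x_neq1.
have n0 : (0 < n)%N by apply: leq_ltn_trans hn.
set F := modified psi r n f.
have w0 : 0 <= w x by exact: jacobi_weight_ge0.
(* The estimate for a single Bernstein operator, uniform over degrees between [n] and [K n]. *)
have key m : (n <= m)%N -> m%:R <= K * n%:R ->
    w x * `|phi x| ^+ r * `|\sum_(k < m.+1) F (k%:R / m%:R) *
       (bernstein_basis R m k)^`N(r).[x]| * r`!%:R
    <= E * Num.sqrt n%:R ^+ r * N.
  move=> nm mK; have m0 : (0 < m)%N := leq_trans n0 nm.
  have s0 := sqrtr_ge0 (x * (1 - x)).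
  set s := Num.sqrt (x * (1 - x)) in s0.
  have sqrt_m : Num.sqrt m%:R ^+ r <= (Num.sqrt L * Num.sqrt n%:R) ^+ r.
    rewrite lerXn2r ?nnegrE ?mulr_ge0 ?sqrtr_ge0 // -sqrtrM ?(ltW L0) //.
    by rewrite ler_wsqrtr // (le_trans mK) // ler_wpM2r.
  have -> : E * Num.sqrt n%:R ^+ r * N = D * N * M ^+ r *
      (ratio_const R a * (Num.sqrt L * Num.sqrt n%:R) ^+ r) * r`!%:R.
    by rewrite /E exprMn; ring.
  rewrite ler_wpM2r //.
  apply: (@le_trans _ _ (D * N * M ^+ r * (s ^+ r * \sum_(k < m.+1)
      `|(bernstein_basis R m k)^`N(r).[x]| * weight_ratio a m k x))); last first.
    rewrite ler_wpM2l ?mulr_ge0 ?exprn_ge0 ?(ltW M0) ?(ltW D0) //.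
    apply: le_trans (sum_bernstein_basis_nderivn_le a r m0 x01) _.
    by rewrite ler_wpM2l // ltW.
  rewrite mulrA !mulr_sumr.
  apply: le_trans (ler_wpM2l _ (ler_norm_sum _ _ _)) _.
    by rewrite mulr_ge0 ?exprn_ge0.
  rewrite mulr_sumr; apply: ler_sum => k _.
  have km : (k <= m)%N by rewrite -ltnS.
  have FW : w x * `|F (k%:R / m%:R)| <= D * (N * weight_ratio a m k x).
    exact: (modified_value_le ha hb' hf hn nm km x01 hpsi).
  have phi_s : `|phi x| ^+ r <= (M * s) ^+ r.
    by rewrite lerXn2r ?nnegrE ?mulr_ge0 ?(ltW M0) // phiM.
  rewrite normrM; set b := `|(bernstein_basis R m k)^`N(r).[x]|.
  have -> : w x * `|phi x| ^+ r * (`|F (k%:R / m%:R)| * b) =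
      w x * `|F (k%:R / m%:R)| * `|phi x| ^+ r * b by ring.
  have -> : D * N * M ^+ r * s ^+ r * (b * weight_ratio a m k x) =
      D * (N * weight_ratio a m k x) * (M * s) ^+ r * b.
    by rewrite exprMn; ring.
  apply: ler_wpM2r; first exact: normr_ge0.
  by apply: ler_pM FW phi_s; [apply: mulr_ge0 | apply: exprn_ge0].
rewrite derive1n_bernstein_comb normrM [`|w x * _|]normrM normrX (ger0_norm w0).
apply: le_trans (ler_wpM2l _ (ler_norm_sum _ _ _)) _.
  by rewrite mulr_ge0 ?exprn_ge0.
rewrite mulr_sumr.
(* Applying [key] to each operator leaves the sum of [|coef n i|], at most [K <= L]. *)
apply: (@le_trans _ _ (\sum_(i < r.-1) `|coef n i| * (E * Num.sqrt n%:R ^+ r * N))).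
  apply: ler_sum => i _; have [nm mK] := scheme_nodes_bounds hs n0 (ltn_ord i).
  rewrite normrMn normrM -[_ *+ r`!]mulr_natr.
  rewrite -/F; move: (key _ nm mK); set S := `|\sum_(k < _) _| => keyS.
  have -> : w x * `|phi x| ^+ r * (`|coef n i| * S * r`!%:R) =
    `|coef n i| * (w x * `|phi x| ^+ r * S * r`!%:R) by ring.
  exact: ler_wpM2l.
have -> : L * E * Num.sqrt n%:R ^+ r * N = L * (E * Num.sqrt n%:R ^+ r * N).
  by ring.
rewrite -mulr_suml; apply: ler_wpM2r.
  by rewrite mulr_ge0 // mulr_ge0 ?exprn_ge0 ?sqrtr_ge0 // ltW.
exact: le_trans (scheme_coef_bounded hs n0) KL.
Qed.
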